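(* Let $k\ge 1$ be an integer and let $\Gamma$ be a $k$-star with $n\geq 2k+1$ vertices. Suppose $G<S_n$ and that $(\Gamma,G)$ is a reciprocal pair. Then the following hold: 1. $n=r(k+1)+k$ for some $r\in\mathbb{N}$. 2. With this $r$, $G=\bar{G}\times S_k$ for some $\bar{G}\leq S_{r(k+1)}$, where either (a) $(S_{k+1})^r\leq\bar{G}\leq S_{k+1}\wr S_r$, if $k$ is odd, or (b) $(S_{k+1})^r\leq\bar{G}\leq S_{k+1}\wr A_r$, if $k$ is even.
   Context: Graphs are finite and simple. For integers $1\le k<n$, the $k$-star with $n$ vertices is the graph with vertex set $\{1,\dots,n\}$ in which two distinct vertices are adjacent if and only if at least one of them lies in $\{1,\dots,k\}$. (So the vertices $1,\dots,k$, the centre, form a complete graph; each of the remaining $n-k$ vertices, the points, is adjacent to every centre vertex; and no two points are adjacent.) For a permutation group $G$ on a finite set $\Omega$ of size $n$, the cycle polynomial is $F_G(x)=\sum_{g\in G}x^{c(g)}$, where $c(g)$ is the number of cycles of $g$ on $\Omega$, including fixed points. For a graph $\Gamma$, the chromatic polynomial $P_\Gamma(x)$ is the polynomial whose value at each positive integer $c$ is the number of proper colourings of $\Gamma$ with $c$ colours. Let $G$ be a group of automorphisms of $\Gamma$ (a subgroup of $\mathrm{Aut}(\Gamma)$). For $g\in G$, let $\Gamma/g$ be the graph obtained by contracting each cycle of $g$ to a single vertex, and let $P_{\Gamma/g}(x)$ be its chromatic polynomial, which counts the proper colourings of $\Gamma$ fixed by $g$; if some cycle of $g$ contains both ends of an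 edge of $\Gamma$, then $\Gamma/g$ has a loop and $P_{\Gamma/g}(x)=0$. The orbital chromatic polynomial is $P_{\Gamma,G}(x)=\sum_{g\in G}P_{\Gamma/g}(x)$. $(\Gamma,G)$ is a reciprocal pair if $\Gamma$ is a simple graph with $n$ vertices, $G$ is a group of automorphisms of $\Gamma$ (viewed as a permutation group on the vertices), and $P_{\Gamma,G}(x)=(-1)^nF_G(-x)$. In the decomposition $G=\bar G\times S_k$, the factor $S_k$ is the symmetric group on the centre $\{1,\dots,k\}$ (fixing all points) and $\bar G$ acts on the set of $n-k=r(k+1)$ points $\{k+1,\dots,n\}$ (fixing the centre), so $\bar G\le S_{r(k+1)}$. The groups $(S_{k+1})^r$, $S_{k+1}\wr S_r$ and $S_{k+1}\wr A_r$ are regarded as permutation groups on the points via the imprimitive action with respect to some partition of the points into $r$ blocks of size $k+1$: $(S_{k+1})^r$ is the direct product of the symmetric groups on the blocks, and the top group $S_r$ or $A_r$ permutes the blocks. *)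

(* Defs.v *)
From mathcomp Require Import all_boot all_order all_algebra.
From mathcomp Require Import all_fingroup all_solvable.
(* [Sym] is also a name of alt.v; here [Sym S] is the one of perm.v, the group
   of permutations with support in S. *)
From mathcomp Require Import perm.

Set Implicit Arguments.
Unset Strict Implicit.
Unset Printing Implicit Defensive.

Import GRing.Theory Num.Theory.
Local Open Scope ring_scope.

(* A graph on T is given by its adjacency relation. Loops are allowed here,
   because contracting the cycles of a permutation may create them; simplicity
   is required in [reciprocal_pair]. *)
Definition proper_colourings (T : finType) (e : rel T) (c : nat) :
    {set {ffun T -> 'I_c}} :=
  [set f : {ffun T -> 'I_c} | [forall x, forall y, e x y ==> (f x != f y)]].

Definition is_chromatic_poly (T : finType) (e : rel T) (p : {poly int}) : Prop :=
  forall c : nat, (0 < c)%N -> p.[c%:R] = #|proper_colourings e c|%:R.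

Lemma is_chromatic_poly_unique (T : finType) (e : rel T) (p q : {poly int}) :
  is_chromatic_poly e p -> is_chromatic_poly e q -> p = q.
Proof.
move=> hp hq; apply/eqP; rewrite -subr_eq0; apply/negPn/negP => nz.
pose s := [seq (i.+1)%:R : int | i <- iota 0 (size (p - q)%R)].
have : (size s < size (p - q)%R)%N.
  apply: max_poly_roots nz _ _.
    apply/allP => _ /mapP[i _ ->]; rewrite /root hornerD hornerN.
    by rewrite hp // hq // subrr.
  by rewrite map_inj_uniq ?iota_uniq // => i j /eqP; rewrite eqr_nat => /eqP [].
by rewrite size_map size_iota ltnn.
Qed.

Lemma card_respecting (T : finType) (q : seq (T * T)) :
  {m : nat | forall c : nat,
    #|[set f : {ffun T -> 'I_c} | all (fun z => f z.1 == f z.2) q]| = (c ^ m)%N}.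
Proof.
pose e := [rel x y | ((x, y) \in q) || ((y, x) \in q)].
have sym : connect_sym e by apply: sym_connect_sym => x y /=; rewrite orbC.
pose U : finType := {x : T | fingraph.root e x == x}.
have rP x : fingraph.root e (fingraph.root e x) == fingraph.root e x.
  by rewrite (root_root sym).
exists #|U| => c.
pose g (h : {ffun U -> 'I_c}) : {ffun T -> 'I_c} :=
  [ffun x => h (exist _ (fingraph.root e x) (rP x))].
have g_inj : injective g.
  move=> h1 h2 eq_h; apply/ffunP => u.
  have := congr1 (fun f : {ffun T -> 'I_c} => f (val u)) eq_h.
  rewrite !ffunE; set v := exist _ _ _; suff -> : v = u by [].
  by apply/val_inj/eqP/(valP u).
have -> : [set f : {ffun T -> 'I_c} | all (fun z => f z.1 == f z.2) q] =
          [set g h | h in [set: {ffun U -> 'I_c}]].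
  apply/setP => f; rewrite inE; apply/idP/imsetP => [/allP fq | [h _ ->]].
    have conn x y : connect e x y -> f x = f y.
      case/connectP => s; elim: s x => [|z s IH] x /=; first by move=> _ ->.
      case/andP=> /orP[] /fq /eqP /= E /IH{}IH /IH <-; by rewrite E.
    exists [ffun u => f (val u)] => //; apply/ffunP => x; rewrite !ffunE /=.
    exact/conn/connect_root.
  apply/allP => -[x y] xyq /=; rewrite !ffunE; apply/eqP; congr (h _).
  apply/val_inj => /=; apply/(fingraph.rootP sym)/connect1.
  by rewrite /= xyq.
by rewrite card_imset // cardsT card_ffun card_ord.
Qed.

Lemma chromatic_poly_exists (T : finType) (e : rel T) :
  {p : {poly int} | is_chromatic_poly e p}.
Proof.
pose N (s q : seq (T * T)) (c : nat) := [set f : {ffun T -> 'I_c} |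
  all (fun z => f z.1 != f z.2) s && all (fun z => f z.1 == f z.2) q].
have NP s : forall q, {p : {poly int} | forall c, p.[c%:R] = #|N s q c|%:R}.
  elim: s => [|z s IH] q.
    have [m mP] := card_respecting q; exists ('X^m) => c.
    by rewrite hornerXn -natrX -mP.
  have [[p1 p1P] [p2 p2P]] := (IH q, IH (z :: q)).
  exists (p1 - p2) => c; rewrite hornerD hornerN p1P p2P.
  rewrite -(cardsID [set f : {ffun T -> 'I_c} | f z.1 == f z.2] (N s q c)).
  have -> : N s q c :&: [set f : {ffun T -> 'I_c} | f z.1 == f z.2] =
            N s (z :: q) c.
    by apply/setP => f; rewrite !inE /= andbC andbCA.
  have -> : N s q c :\: [set f : {ffun T -> 'I_c} | f z.1 == f z.2] =
            N (z :: s) q c.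
    by apply/setP => f; rewrite !inE /= andbA.
  by rewrite natrD addrAC subrr add0r.
have [p pP] := NP [seq z <- enum {: T * T} | e z.1 z.2] [::].
exists p => c _; rewrite pP; congr (#|pred_of_set _|%:R).
apply/setP => f; rewrite !inE andbT; apply/allP/forallP => [H x | H [x y]].
  apply/forallP => y; apply/implyP => exy.
  by apply: (H (x, y)); rewrite mem_filter /= exy mem_enum.
by rewrite mem_filter /= => /andP[exy _]; have /forallP/(_ y)/implyP/(_ exy) := H x.
Qed.

Definition chromatic_poly (T : finType) (e : rel T) : {poly int} :=
  sval (chromatic_poly_exists e).

Lemma chromatic_polyP (T : finType) (e : rel T) :
  is_chromatic_poly e (chromatic_poly e).
Proof. exact: svalP (chromatic_poly_exists e). Qed.

Definition graph_aut (T : finType) (e : rel T) : {set {perm T}} :=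
  [set g : {perm T} | [forall x, forall y, e (g x) (g y) == e x y]].

Definition cycle_poly (T : finType) (G : {group {perm T}}) : {poly int} :=
  \sum_(g in G) 'X^(#|porbits g|).

(* The vertices of the contracted graph are the cycles of g. A cycle containing
   both ends of an edge is adjacent to itself. *)
Definition contracted_rel (T : finType) (e : rel T) (g : {perm T}) :
    rel {B : {set T} | B \in porbits g} :=
  fun B C => [exists x in val B, exists y in val C, e x y].

Definition orbital_chromatic_poly (T : finType) (e : rel T)
    (G : {group {perm T}}) : {poly int} :=
  \sum_(g in G) chromatic_poly (@contracted_rel T e g).

Definition reciprocal_pair (T : finType) (e : rel T) (G : {group {perm T}}) :
    Prop :=
  [/\ symmetric e,
      irreflexive e,
      G \subset graph_aut e
    & orbital_chromatic_poly e G = (-1) ^+ #|T| * (cycle_poly G \Po (- 'X))].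

(* Vertices are numbered from 0, so that the centre is {0, ..., k-1}. *)
Definition centre (n k : nat) : {set 'I_n} := [set i : 'I_n | (i < k)%N].

Definition points (n k : nat) : {set 'I_n} := ~: centre n k.

Definition kstar (n k : nat) : rel 'I_n :=
  fun i j => (i != j) && ((i \in centre n k) || (j \in centre n k)).

(* The imprimitive action of 'S_m wr Q, for Q a set of permutations of the r
   blocks, on the image of an injective labelling phi : 'I_r * 'I_m -> T. The
   i-th block is phi (i, _), and the element with base component f and top
   component s maps phi (i, a) to phi (s i, f i a). *)
Definition imprimitive_wreath (T : finType) (r m : nat)
    (phi : 'I_r * 'I_m -> T) (Q : {set 'S_r}) : {set {perm T}} :=
  [set g in Sym [set phi p | p : 'I_r * 'I_m] |
    [exists s in Q, exists f : {ffun 'I_r -> 'S_m},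
      forall i, forall a, g (phi (i, a)) == phi (s i, f i a)]].

(* The base group ('S_m)^r: every block is mapped to itself by an arbitrary
   permutation, independently of the other blocks. *)
Definition imprimitive_base (T : finType) (r m : nat)
    (phi : 'I_r * 'I_m -> T) : {set {perm T}} :=
  imprimitive_wreath phi [set 1%g].

Definition block_labelling (T : finType) (r m : nat)
    (phi : 'I_r * 'I_m -> T) (D : {set T}) : Prop :=
  injective phi /\ [set phi p | p : 'I_r * 'I_m] = D.

(* Main.v *)
(* With k = #|A| for the centre A, only the elements of G fixing A pointwise
   contribute to the orbital chromatic polynomial, and reciprocity reads
     x (x-1) ... (x-k+1) * sum_h (x-k)^(c(h)-k) = sum_g sgn(g) x^c(g),
   h running over those elements and g over G.
   The value of the right hand side at a natural number c is a sum over the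
   c-colourings of the vertices, to which only those whose stabiliser in G is
   even contribute. At c = k+1 the left hand side is positive, so some
   (k+1)-colouring has an even stabiliser. It separates x and y whenever the
   transposition (x y) is in G, so each class of the equivalence relation
   (x y) \in G has at most k+1 elements, and at most k inside A.
   Comparing the coefficients of x^(n-1) counts the transpositions of G and
   shows that all these bounds are attained: A is a class, whence Sym A <= G,
   and the other classes are blocks of size k+1 permuted by G. When k is even,
   an element of G inducing an odd permutation of the blocks would yield an odd
   element of G preserving the colouring found above. *)
Require Import Defs.
From mathcomp Require Import all_boot all_order all_algebra.
From mathcomp Require Import all_fingroup all_solvable.
From mathcomp Require Import perm zify.

Set Implicit Arguments.
Unset Strict Implicit.
Unset Printing Implicit Defensive.

Import GroupScope GRing.Theory Num.Theory.

(** * Cycle counts and transpositions *)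

Lemma porbit_fixed (T : finType) (g : {perm T}) (x : T) :
  g x = x -> porbit g x = [set x].
Proof.
move=> gx; apply/setP => y; rewrite inE; apply/porbitP/eqP => [[i ->]|->].
  by elim: i => [|i IH]; rewrite ?expg0 ?perm1 // expgSr permM IH gx.
by exists 0; rewrite expg0 perm1.
Qed.

Lemma card_porbits1 (T : finType) : #|porbits (1 : {perm T})| = #|T|.
Proof.
rewrite /porbits card_imset // => x y.
by rewrite !porbit_fixed ?perm1 // => /set1_inj.
Qed.

Lemma card_porbits_le (T : finType) (g : {perm T}) : #|porbits g| <= #|T|.
Proof. exact: leq_imset_card. Qed.

Lemma card_porbits_eq_id (T : finType) (g : {perm T}) :
  #|porbits g| = #|T| -> g = 1.
Proof.
move=> cg; have inj : {in [set: T] &, injective (porbit g)}.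
  apply/imset_injP; rewrite cardsT -cg; apply/eqP; congr #|pred_of_set _|.
  by apply/setP => B; apply/imsetP/imsetP => -[x _ ->]; exists x.
by apply/permP => x; rewrite perm1; apply: inj => //; apply: (porbit_perm _ 1).
Qed.

Lemma card_porbits_tperm (T : finType) (x y : T) :
  x != y -> #|porbits (tperm x y)|.+1 = #|T|.
Proof.
move=> nxy; have /= := porbits_mul_tperm 1 x y; rewrite mulg1 card_porbits1.
by rewrite porbit_fixed ?perm1 // inE nxy addn2 addn1 => -[].
Qed.

(** Multiplying [g] by [tperm x (g x)] at a moved point [x] splits a cycle; the product then has as
    many cycles as there are points, so it is the identity. *)
Lemma tperm_of_card_porbits (T : finType) (g : {perm T}) :
  #|porbits g|.+1 = #|T| -> exists x y, x != y /\ g = tperm x y.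
Proof.
move=> cg; have [x gx] : exists x, g x != x.
  apply/existsP; apply: contraT; rewrite negb_exists => /forallP fixg.
  suff g1 : g = 1.
    by move: cg; rewrite g1 card_porbits1 => /eqP; rewrite eqn_leq ltnn.
  by apply/permP => x; rewrite perm1; apply/eqP; have := fixg x; rewrite negbK.
exists x, (g x); split; first by rewrite eq_sym.
have /= := porbits_mul_tperm g x (g x).
rewrite porbit_sym (mem_porbit _ 1) /= addn0 eq_sym gx addn1 cg.
move=> /card_porbits_eq_id tg1; apply: (mulgI (tperm x (g x))).
by rewrite tg1 tperm2.
Qed.

Lemma card_moved_tperm (T : finType) (x y : T) :
  x != y -> [set z | tperm x y z != z] = [set x; y].
Proof.
move=> nxy; apply/setP => z; rewrite !inE.
by case: tpermP => [->|->|/eqP/negPf-> /eqP/negPf->];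
  rewrite ?eqxx ?(negPf nxy) ?orbT // eq_sym.
Qed.

(** Conjugating [tperm y z] by [tperm x y] gives [tperm x z]. This is the transitivity of the
    relation whose classes outside the centre become the blocks. *)
Lemma mem_tperm_trans (T : finType) (G : {group {perm T}}) (x y z : T) :
  tperm x y \in G -> tperm y z \in G -> tperm x z \in G.
Proof.
move=> xyG yzG; have [->|nzx] := eqVneq z x; first by rewrite tperm1 group1.
have [->//|nzy] := eqVneq z y.
have := groupJ yzG xyG; rewrite tpermJ tpermR tpermD // eq_sym //.
Qed.

(* Multiplying g by the transposition (x, g x) yields a permutation with one
   more fixed point. *)
Lemma mem_of_tperms (T : finType) (G : {group {perm T}}) (g : {perm T}) :
  (forall x, tperm x (g x) \in G) -> g \in G.
Proof.
have [m] := ubnP #|[set x | g x != x]|; elim: m g => // m IH g.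
rewrite ltnS => cm gG; have [fixg|] := boolP [forall x, g x == x].
  suff -> : g = 1 by apply: group1.
  by apply/permP => x; rewrite perm1; apply/eqP; apply: (forallP fixg).
rewrite negb_forall => /existsP[x gx]; pose t := tperm x (g x).
rewrite -(groupMr _ (gG x)); apply: IH => [|y].
  apply: leq_trans cm; apply: proper_card; apply/properP; split.
    apply/subsetP => y; rewrite !inE permM; apply: contraNN => /eqP gy.
    have nxy : x != y by apply: contraNneq gx => ->; rewrite gy.
    by rewrite gy tpermD // -gy (inj_eq perm_inj).
  by exists x; rewrite !inE // permM tpermR eqxx.
rewrite permM; case: tpermP => [gy|/perm_inj ->|_ _]; last exact: gG.
  by apply: mem_tperm_trans (gG x); rewrite -gy.
by rewrite tperm1 group1.
Qed.

(** * Invariant colourings and the signed cycle polynomial *)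

(** Such a colouring is constant on the cycles of [g], hence comes from exactly one colouring of the
    set of cycles. *)
Lemma card_fixed_colourings (T : finType) (g : {perm T}) (c : nat) :
  #|[set f : {ffun T -> 'I_c} | [forall x, f (g x) == f x]]|
  = (c ^ #|porbits g|)%N.
Proof.
pose V := {B : {set T} | B \in porbits g}.
have pP x : porbit g x \in porbits g by apply: imset_f.
pose lift (h : {ffun V -> 'I_c}) : {ffun T -> 'I_c} :=
  [ffun x => h (exist _ (porbit g x) (pP x))].
have lift_inj : injective lift.
  move=> h1 h2 eqh; apply/ffunP => -[B PB]; have /imsetP[x _ Bx] := PB.
  have := congr1 (fun f : {ffun T -> 'I_c} => f x) eqh; rewrite !ffunE.
  by have -> : exist _ (porbit g x) (pP x) = exist _ B PB :> V by exact/val_inj.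
have -> : [set f : {ffun T -> 'I_c} | [forall x, f (g x) == f x]]
          = lift @: setT.
  apply/setP => f; rewrite inE; apply/forallP/imsetP => [fg | [h _ ->] x].
    have fo x y : y \in porbit g x -> f y = f x.
      case/porbitP => i ->; elim: i => [|i IH]; first by rewrite expg0 perm1.
      by rewrite expgSr permM (eqP (fg _)).
    have rP (B : V) : exists x, val B = porbit g x.
      by case: B => B /= /imsetP[x _ ->]; exists x.
    have [r rE] := fin_all_exists rP.
    exists [ffun B => f (r B)] => //; apply/ffunP => x; rewrite !ffunE.
    by apply: fo; rewrite -rE porbit_id.
  rewrite !ffunE; apply/eqP; congr (h _); apply/val_inj => /=.
  exact: (porbit_perm _ 1).
by rewrite card_imset // cardsT card_ffun card_ord card_sig.
Qed.

(** The sign of [g] is (-1)^(|T| - c(g)), which absorbs both the global sign and the sign of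
    (-x)^c(g). *)
Lemma signed_cycle_poly (T : finType) (G : {group {perm T}}) :
  ((-1) ^+ #|T| * (cycle_poly G \Po (- 'X)) =
   \sum_(g in G) (-1) ^+ (odd_perm g) * 'X^(#|porbits g|))%R.
Proof.
rewrite /cycle_poly raddf_sum mulr_sumr; apply: eq_bigr => g _ /=.
rewrite comp_Xn_poly (exprNn 'X) mulrA; congr (_ * _)%R.
by rewrite /odd_perm signr_addb !signr_odd.
Qed.

(* The value at c counts c-colourings f weighted by the sum of the signs over
   the stabiliser of f, which vanishes once that stabiliser is not even. *)
Lemma signed_cycle_poly_eq0 (T : finType) (G : {group {perm T}}) (c : nat) :
  (forall f : {ffun T -> 'I_c},
     exists g, [/\ g \in G, odd_perm g & forall x, f (g x) = f x]) ->
  ((\sum_(g in G) (-1) ^+ (odd_perm g) * 'X^(#|porbits g|) : {poly int}).[c%:R]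
   = 0)%R.
Proof.
move=> oddst; rewrite horner_sum.
transitivity (\sum_(g in G) \sum_(f : {ffun T -> 'I_c} |
                 [forall x, f (g x) == f x]) (-1) ^+ (odd_perm g) : int)%R.
  apply: eq_bigr => g _; rewrite sumr_const hornerM hornerXn -natrX.
  rewrite -card_fixed_colourings cardsE mulr_natr; congr (_ *+ _)%R.
  by case: (odd_perm g); rewrite ?hornerN hornerC.
rewrite (exchange_big_dep predT) //=; apply: big1 => f _.
have [t [tG todd ft]] := oddst f.
(* [S] sums the signs over the stabiliser of [f]; translation by the odd element [t] permutes this
   stabiliser and reverses every sign. *)
set S := (LHS); suff : S = (- S)%R.
  by move/eqP; rewrite -subr_eq0 opprK -mulr2n mulrn_eq0 => /eqP.
rewrite {1}/S (reindex_inj (mulIg t)) -sumrN; apply: eq_big => g.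
  rewrite groupMr //; congr (_ && _); apply: eq_forallb => x.
  by rewrite permM ft.
by rewrite odd_permM todd addbT signrN.
Qed.

(** * The chromatic polynomial of a star *)

(** Roots, with multiplicity, of x(x-1)...(x-k+1)(x-k)^m, the chromatic polynomial of a [k]-star
    with [m] points. A product over roots gives access to its two highest coefficients. *)
Definition star_roots (k m : nat) : seq int :=
  ([seq i%:R | i <- iota 0 k] ++ nseq m k%:R)%R.

Definition star_poly (k m : nat) : {poly int} :=
  (\prod_(a <- star_roots k m) ('X - a%:P))%R.

Lemma size_star_roots (k m : nat) : size (star_roots k m) = (k + m)%N.
Proof. by rewrite size_cat size_map size_iota size_nseq. Qed.

Lemma star_poly_horner (k m c : nat) :
  (star_poly k m).[c%:R]%R = (c ^_ k * (c - k) ^ m)%:R%R.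
Proof.
rewrite /star_poly horner_prod big_cat big_map big_nseq_cond iter_mulr_1 /=.
(* For [c < k] the truncated difference [c - k] does no harm: the falling factorial vanishes, and so
   does the factor of the root [c]. *)
rewrite hornerXsubC natrM; have [ltck|lekc] := ltnP c k.
  rewrite ffact_small // !mul0r (bigD1_seq c) ?iota_uniq ?mem_iota //=.
  by rewrite hornerXsubC subrr !mul0r.
rewrite natrX natrB //; congr (_ * _)%R; rewrite ffact_prod natr_prod.
have -> : iota 0 k = index_iota 0 k by rewrite /index_iota subn0.
rewrite big_mkord; apply: eq_bigr => i _.
by rewrite hornerXsubC natrB // ltnW // (leq_trans (ltn_ord i)).
Qed.

Lemma card_star_colourings (V : finType) (A : {set V}) (e : rel V) (c : nat) :
  e =2 (fun x y => (x != y) && ((x \in A) || (y \in A))) ->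
  #|proper_colourings e c| = (c ^_ #|A| * (c - #|A|) ^ #|~: A|)%N.
Proof.
move=> eE; pose U := {x : V | x \in A}.
pose res (f : {ffun V -> 'I_c}) : {ffun U -> 'I_c} := [ffun u => f (val u)].
have proper_inj f : f \in proper_colourings e c -> injectiveb (res f).
  rewrite inE => /forallP fP; apply/injectiveP => u v; rewrite !ffunE => fuv.
  apply/val_inj/eqP; apply: contraT => nuv.
  by have /forallP/(_ (val v)) := fP (val u); rewrite eE nuv (valP u) fuv eqxx.
rewrite -sum1_card (partition_big res (fun h => injectiveb h)) //=.
pose F (h : {ffun U -> 'I_c}) (x : V) : pred 'I_c :=
  if insub x is Some u then pred1 (h u) else predC (mem (codom h)).
transitivity (\sum_(h : {ffun U -> 'I_c} | injectiveb h)
                (c - #|A|) ^ #|~: A|)%N; last first.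
  by rewrite sum_nat_const -cardsE card_inj_ffuns card_ord card_sig.
apply: eq_bigr => h /injectiveP h_inj.
transitivity #|family (F h)|.
  rewrite -sum1_card; apply: eq_bigl => f; apply/andP/familyP.
    case=> fP /eqP <- x; rewrite /F; case: insubP => [u _ <-|xA].
      by rewrite inE ffunE.
    rewrite !inE; apply/codomP => -[u]; rewrite ffunE => fxu.
    move: fP; rewrite inE => /forallP/(_ x)/forallP/(_ (val u)).
    rewrite eE (valP u) orbT andbT fxu eqxx implybF negbK => /eqP xu.
    by rewrite xu (valP u) in xA.
  move=> fF; have resE : res f = h.
    apply/ffunP => u; rewrite ffunE; have := fF (val u).
    by rewrite /F valK inE => /eqP.
  have fA x : x \in A -> exists2 u : U, x = val u & f x = h u.
    by move=> xA; exists (Sub x xA) => //; rewrite -resE ffunE.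
  split; last exact/eqP.
  have fAP x y : x != y -> x \in A -> f x != f y.
    move=> nxy /fA[u xu ->]; have [yA|yA] := boolP (y \in A).
      have [v yv ->] := fA _ yA; rewrite (inj_eq h_inj).
      by apply: contraNneq nxy => uv; rewrite xu yv uv.
    have := fF y; rewrite /F insubN // !inE.
    by apply: contraNneq => <-; apply: codom_f.
  rewrite inE; apply/forallP => x; apply/forallP => y; rewrite eE.
  apply/implyP => /andP[nxy /orP[]]; first exact: fAP.
  by rewrite eq_sym; apply: fAP; rewrite eq_sym.
rewrite card_family foldrE big_map big_enum /= (bigID (mem A)) /=.
rewrite big1 ?mul1n => [|x xA]; last by rewrite /F insubT card1.
rewrite -[in RHS]prod_nat_const; apply: eq_big => [x|x xA]; first by rewrite inE.
rewrite /F insubN //; have := cardC (mem (codom h)).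
by rewrite card_codom // card_ord card_sig => cE; rewrite -[in RHS]cE addKn.
Qed.

Lemma chromatic_poly_star (V : finType) (A : {set V}) (e : rel V) :
  e =2 (fun x y => (x != y) && ((x \in A) || (y \in A))) ->
  chromatic_poly e = star_poly #|A| #|~: A|.
Proof.
move=> eE; apply: is_chromatic_poly_unique (chromatic_polyP e) _ => c _.
by rewrite star_poly_horner (card_star_colourings _ eE).
Qed.

(** * Automorphisms and contractions of stars *)

(** An arbitrary centre removes the numbering of vertices from the argument; [star (centre n k)]
    unfolds to the same relation as [kstar n k]. *)
Definition star (T : finType) (A : {set T}) : rel T :=
  fun x y => (x != y) && ((x \in A) || (y \in A)).

(** A vertex of [A] is adjacent to all others, whereas a vertex outside [A] has a non-neighbour,
    there being at least two such vertices. *)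
Lemma star_aut_mem (T : finType) (A : {set T}) (g : {perm T}) (x : T) :
  1 < #|~: A| -> g \in graph_aut (star A) -> (g x \in A) = (x \in A).
Proof.
move=> A2; rewrite inE => /forallP gA.
have ge y z : star A (g y) (g z) = star A y z by apply/eqP/(forallP (gA y)).
have other y : exists2 z, z != y & z \notin A.
  have := A2; rewrite (cardsD1 y); case: (_ \in _) => [|/ltnW] /card_gt0P[z].
    by rewrite !inE => /andP[zy zA]; exists z.
  by rewrite !inE => /andP[zy zA]; exists z.
apply/idP/idP => [gxA|xA]; apply: contraT => nA.
  have [z zx zA] := other x; have := ge x z.
  by rewrite /star (inj_eq perm_inj) gxA (negPf nA) (negPf zA) eq_sym zx.
have [z zx zA] := other (g x); have := ge x (g^-1 z).
rewrite permKV /star (negPf nA) (negPf zA) eq_sym zx xA /= andbT eq_sym.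
by rewrite -(inj_eq (@perm_inj _ g)) permKV zx.
Qed.

Definition fixes (T : finType) (A : {set T}) (g : {perm T}) : bool :=
  [forall x in A, g x == x].

(** If [g] moves some [x] in [A], the edge from [x] to [g x] becomes a loop. Otherwise the
    contraction is again a star, centred at the singleton cycles of [A]. *)
Lemma chromatic_poly_contracted_star (T : finType) (A : {set T}) (g : {perm T}) :
  (forall x, (g x \in A) = (x \in A)) ->
  chromatic_poly (@contracted_rel T (star A) g) =
  if fixes A g then star_poly #|A| (#|porbits g| - #|A|) else 0%R.
Proof.
move=> gA; pose V := {B : {set T} | B \in porbits g}.
have pP x : porbit g x \in porbits g by apply: imset_f.
pose pr x : V := exist _ (porbit g x) (pP x).
have [/forall_inP fixA|] := boolP (fixes A g); last first.
  rewrite negb_forall_in => /exists_inP[x xA gx].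
  apply: is_chromatic_poly_unique (chromatic_polyP _) _ => c _.
  rewrite horner0 (_ : proper_colourings _ c = set0) ?cards0 //.
  apply/setP => f; rewrite !inE; apply/negP => /forallP fP.
  have /forallP/(_ (pr x)) := fP (pr x); rewrite eqxx implybF.
  apply/negP; rewrite negbK; apply/existsP; exists x.
  rewrite porbit_id; apply/existsP; exists (g x).
  by rewrite (mem_porbit _ 1) /star eq_sym gx xA.
have pr1 x : x \in A -> val (pr x) = [set x].
  by move=> xA; rewrite /= porbit_fixed //; apply/eqP/fixA.
have memV (B : V) x : x \in val B -> B = pr x.
  case: B => B PB /= xB; apply/val_inj => /=; have /imsetP[y _ By] := PB.
  by apply/eqP; rewrite By eq_porbit_mem porbit_sym -By.
have V0 (B : V) : exists x, x \in val B.
  by case: B => B /= /imsetP[y _ ->]; exists y; rewrite porbit_id.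
have relE : @contracted_rel T (star A) g =2
    (fun B C => (B != C) && ((B \in pr @: A) || (C \in pr @: A))).
  move=> B C; apply/existsP/idP => [[x /andP[xB /existsP[y]]]|].
    case/and3P=> yC nxy xyA.
    have [BE CE] := (memV _ _ xB, memV _ _ yC).
    move: xB yC; rewrite {}BE {}CE => xB yC.
    apply/andP; split; last first.
      by case/orP: xyA => xyA; rewrite (imset_f pr xyA) ?orbT.
    apply: contraNneq nxy => eqBC; case/orP: xyA => /pr1 E.
      by move: yC; rewrite -eqBC E => /set1P->.
    by move: xB; rewrite eqBC E => /set1P->.
  case/andP=> nBC BCA; have [[x xB] [y yC]] := (V0 B, V0 C).
  exists x; rewrite xB; apply/existsP; exists y; rewrite yC /star /=.
  apply/andP; split.
    by apply: contraNneq nBC => xy; rewrite (memV _ _ xB) (memV _ _ yC) xy.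
  by case/orP: BCA => /imsetP[z zA E];
    [move: xB | move: yC]; rewrite E pr1 // => /set1P->; rewrite zA ?orbT.
have cA : #|pr @: A| = #|A|.
  rewrite card_in_imset // => x y xA yA /(congr1 val).
  by rewrite !pr1 // => /set1_inj.
rewrite (chromatic_poly_star relE) cA; congr star_poly.
by have := cardsC (pr @: A); rewrite cA card_sig => <-; rewrite addKn.
Qed.

(** * Lifting permutations of the blocks *)

(** The witness is the product of the [m] transpositions exchanging [phi (i, a)] and [phi (j, a)],
    one for each label [a]. *)
Lemma block_swap (T : finType) (r m : nat) (phi : 'I_r * 'I_m -> T) (i j : 'I_r) :
  injective phi ->
  exists h : {perm T},
    [/\ forall l a, h (phi (l, a)) = phi (tperm i j l, a),
        forall x, x \notin [set phi p | p : 'I_r * 'I_m] -> h x = x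
      & odd_perm h = odd m && (i != j)].
Proof.
move=> phi_inj; pose t a := tperm (phi (i, a)) (phi (j, a)).
have tE a l b :
  t a (phi (l, b)) = if b == a then phi (tperm i j l, b) else phi (l, b).
  have [->|nba] := eqVneq b a; last first.
    by rewrite tpermD // (inj_eq phi_inj) xpair_eqE eq_sym negb_and orbC eq_sym nba.
  by case: (tpermP i j l) => [->|->|/eqP nli /eqP nlj];
     rewrite ?tpermL ?tpermR // tpermD // (inj_eq phi_inj) xpair_eqE eq_sym
             negb_and ?nli ?nlj.
suff swap_on (S : seq 'I_m) : uniq S -> exists h : {perm T},
    [/\ forall l b, h (phi (l, b)) =
          if b \in S then phi (tperm i j l, b) else phi (l, b),
        forall x, x \notin [set phi p | p : 'I_r * 'I_m] -> h x = x
      & odd_perm h = odd (size S) && (i != j)].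
  have [h [hE hfix hodd]] := swap_on _ (enum_uniq 'I_m); exists h; split=> //.
    by move=> l a; rewrite hE mem_enum.
  by rewrite hodd size_enum_ord.
elim: S => [_|a S IH /= /andP[aS /IH[h [hE hfix hodd]]]].
  by exists 1; split=> [l b|x _|]; rewrite ?perm1 ?odd_perm1.
exists (t a * h); split=> [l b|x xphi|].
- rewrite permM tE inE; have [->|_] := eqVneq b a; first by rewrite hE (negPf aS).
  exact: hE.
- rewrite permM (_ : t a x = x) ?hfix // tpermD //; apply: contraNneq xphi => <-;
  exact: imset_f.
rewrite odd_permM odd_tperm hodd (inj_eq phi_inj) xpair_eqE eqxx andbT.
by case: (odd _); case: (i != j).
Qed.

(** Write [s] as a product of transpositions and lift each by a block swap. For odd [m] the lift has
    the parity of [s]. *)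
Lemma block_lift (T : finType) (r m : nat) (phi : 'I_r * 'I_m -> T) (s : 'S_r) :
  injective phi ->
  exists h : {perm T},
    [/\ forall i a, h (phi (i, a)) = phi (s i, a),
        forall x, x \notin [set phi p | p : 'I_r * 'I_m] -> h x = x
      & odd_perm h = odd m && odd_perm s].
Proof.
move=> phi_inj; have [ts -> _] := prod_tpermP s.
elim: ts => [|[i j] ts [h [hE hfix hodd]]].
  by exists 1; split=> [i a|x _|]; rewrite ?big_nil ?perm1 ?odd_perm1 ?andbF.
have [t [tE tfix todd]] := block_swap i j phi_inj.
exists (t * h); rewrite big_cons; split=> [l a|x xphi|].
- by rewrite !permM tE hE.
- by rewrite permM tfix ?hfix.
by rewrite !odd_permM odd_tperm todd hodd; case: (odd m).
Qed.


(** * Second highest coefficients and transpositions *)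

(** The polynomial is monic of degree [k + j], so this coefficient is minus the sum of the roots,
    the leading 1 or zero, according as [m - j] is 0, 1 or larger. *)
Lemma star_poly_coef (k m j : nat) :
  0 < m -> j <= m ->
  ((star_poly k j)`_(k + m).-1 =
   (j.+1 == m)%:R - (if j == m then (\sum_(0 <= i < k) i + m * k)%:R else 0))%R.
Proof.
move=> m0; rewrite leq_eqVlt => /orP[/eqP->|ltjm].
  rewrite eqxx gtn_eqF // sub0r -size_star_roots coefPn_prod_XsubC; last first.
    by rewrite size_star_roots -lt0n addn_gt0 m0 orbT.
  rewrite big_cat big_map big_nseq_cond /= iter_addr_0 natrD natr_sum.
  by rewrite /index_iota subn0 natrM mulr_natl.
have szp : size (star_poly k j) = (k + j).+1.
  by rewrite size_prod_XsubC size_star_roots.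
rewrite (ltn_eqF ltjm) subr0 -subn1 -addnBA //.
have [eqm|nem] := eqVneq j.+1 m.
  rewrite -eqm subn1 /=; have <- : (size (star_poly k j)).-1 = k + j by rewrite szp.
  exact/monicP/monic_prod_XsubC.
apply: nth_default; rewrite szp ltn_add2l; move: ltjm; rewrite leq_eqVlt (negPf nem).
by rewrite -{1}(subnK m0) addn1 ltnS subn1.
Qed.

(** Having one cycle fewer than there are points characterises transpositions; this is the form in
    which the coefficient of x^(n-1) detects them. *)
Definition transpositions (T : finType) (G : {group {perm T}}) : {set {perm T}} :=
  [set g in G | #|porbits g|.+1 == #|T|].

(** * Reciprocity: an even stabiliser and the number of transpositions *)

Section Reciprocity.

Variables (T : finType) (A : {set T}) (G : {group {perm T}}).
Hypothesis A2 : 1 < #|~: A|.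
Hypothesis recG : reciprocal_pair (star A) G.

Lemma centre_invariant (g : {perm T}) (x : T) : g \in G -> (g x \in A) = (x \in A).
Proof. by case: recG => _ _ /subsetP GA _ /GA; apply: star_aut_mem. Qed.

Lemma star_reciprocity :
  (\sum_(g in G | fixes A g) star_poly #|A| (#|porbits g| - #|A|) =
   \sum_(g in G) (-1) ^+ (odd_perm g) * 'X^(#|porbits g|))%R.
Proof.
rewrite -signed_cycle_poly; case: recG => _ _ _ <-.
rewrite big_mkcondr; apply: eq_bigr => g gG.
by rewrite chromatic_poly_contracted_star // => x; apply: centre_invariant.
Qed.

Lemma even_stabiliser_colouring :
  exists f : {ffun T -> 'I_(#|A|.+1)},
    forall g, g \in G -> (forall x, f (g x) = f x) -> ~~ odd_perm g.
Proof.
pose evenst (f : {ffun T -> 'I_(#|A|.+1)}) :=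
  [forall g in G, [forall x, f (g x) == f x] ==> ~~ odd_perm g].
have [/existsP[f /forall_inP fP]|] := boolP [exists f, evenst f].
  by exists f => g gG fg; apply: (implyP (fP g gG)); apply/forallP => x; apply/eqP.
rewrite negb_exists => /forallP oddst.
have /eqP : ((\sum_(g in G) (-1) ^+ (odd_perm g) * 'X^(#|porbits g|) :
              {poly int}).[#|A|.+1%:R] = 0)%R.
  apply: signed_cycle_poly_eq0 => f.
  have := oddst f; rewrite negb_forall_in => /exists_inP[g gG].
  rewrite negb_imply negbK => /andP[/forallP fg odd_g].
  by exists g; split=> // x; apply/eqP.
(* All terms of the chromatic side are nonnegative at |A|+1, so a zero sum would force the term of
   the identity, which is (|A|+1)!, to vanish. *)
rewrite -star_reciprocity horner_sum psumr_eq0 => [|g _]; last first.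
  by rewrite star_poly_horner ler0n.
have fix1 : fixes A 1 by apply/forall_inP => x _; rewrite perm1.
move/allP/(_ 1 (mem_index_enum _)); rewrite group1 fix1 star_poly_horner pnatr_eq0.
by rewrite subSn // subnn exp1n muln1 eqn0Ngt ffact_gt0 leqnSn.
Qed.

(** In the coefficient of x^(n-1), each transposition counts -1 on the signed side. On the chromatic
    side each transposition fixing [A] pointwise counts 1, and the identity contributes minus the
    sum of the roots. *)
Lemma card_transpositions :
  #|transpositions G| + #|[set g in transpositions G | fixes A g]|
  = \sum_(0 <= i < #|A|) i + #|~: A| * #|A|.
Proof.
have nE := cardsC A; have A0 := ltnW A2.
have fix1 : fixes A 1 by apply/forall_inP => x _; rewrite perm1.
have := congr1 (fun p : {poly int} => (p`_(#|T|.-1))%R) star_reciprocity.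
rewrite !coef_sum => E.
set N := (RHS); have T0 : 0 < #|T|.
  by rewrite -nE addn_gt0 A0 orbT.
move: E.
have -> : (\sum_(g in G) ((-1) ^+ (odd_perm g) * 'X^(#|porbits g|))`_(#|T|.-1) =
           - #|transpositions G|%:R :> int)%R.
  rewrite -sum1_card natr_sum -sumrN [RHS]big_mkcond [LHS]big_mkcond.
  apply: eq_bigr => g _; rewrite inE; case: (g \in G) => //=.
  have -> (b : bool) m i :
      (((-1) ^+ b * 'X^m : {poly int})`_i = (-1) ^+ b * (i == m)%:R)%R.
    by rewrite !mulr_sign; case: b; rewrite ?coefN coefXn.
  have [cg|/eqP ncg] := eqVneq #|porbits g|.+1 #|T|.
    by rewrite -cg /= eqxx mulr1 /odd_perm -cg oddS addNb addbb.
  by case: eqP => [cg|_]; [case: ncg; rewrite -cg prednK | rewrite mulr0].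
have -> : (\sum_(g in G | fixes A g)
              (star_poly #|A| (#|porbits g| - #|A|))`_(#|T|.-1) =
           #|[set g in transpositions G | fixes A g]|%:R - N%:R :> int)%R.
  transitivity (\sum_(g in G | fixes A g) ((#|porbits g|.+1 == #|T|)%:R -
                   (if g == 1%g then N%:R else 0)) : int)%R.
    apply: eq_bigr => g _; rewrite -nE star_poly_coef //; last first.
      by rewrite leq_subLR nE card_porbits_le.
    congr (_%:R - _)%R; first by congr nat_of_bool; lia.
    rewrite (_ : (_ == #|~: A|) = (g == 1)) //.
    apply/eqP/eqP => [cg|->]; last by rewrite card_porbits1 -nE addKn.
    by apply: card_porbits_eq_id; lia.
  rewrite sumrB; congr (_ - _)%R.
    rewrite -[#|[set _ in _ | _]|]sum1_card natr_sum big_mkcond [RHS]big_mkcond.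
    apply: eq_bigr => g _; rewrite !inE.
    by case: (g \in G); case: (fixes A g); case: (_ == _).
  rewrite (bigD1 1) ?group1 ?fix1 //= eqxx big1 ?addr0 // => g /andP[_ /negPf->].
  by [].
by move/eqP; rewrite subr_eq addrC -subr_eq opprK -natrD eqr_nat addnC => /eqP.
Qed.

(** * Sizes of the transposition classes *)

Definition tperm_class (x : T) : {set T} := [set y | tperm x y \in G].

Lemma tperm_class_id (x : T) : x \in tperm_class x.
Proof. by rewrite inE tperm1 group1. Qed.

Lemma tperm_class_mem (x y : T) : y \in tperm_class x -> (y \in A) = (x \in A).
Proof. by rewrite inE => /(centre_invariant x); rewrite tpermL. Qed.

(** Double counting of pairs of a point and a transposition of [G] moving it: [y] corresponds to
    [tperm x y]. *)
Lemma sum_card_tperm_class (S : {set T}) :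
  \sum_(x in S) #|tperm_class x :\ x| =
  \sum_(g in transpositions G) #|[set x in S | g x != x]|.
Proof.
transitivity (\sum_(x in S) \sum_(g in transpositions G | g x != x) 1).
  apply: eq_bigr => x _.
  have tx_inj : injective (tperm x) by move=> y z /permP/(_ x); rewrite !tpermL.
  rewrite sum1dep_card -(card_imset _ tx_inj); congr #|pred_of_set _|.
  apply/setP => g; apply/imsetP/idP => [[y /setD1P[nyx yG] ->]|].
    rewrite inE in yG; rewrite !inE yG tpermL nyx card_porbits_tperm ?eqxx //.
    by rewrite eq_sym.
  rewrite !inE => /andP[/andP[gG /eqP/tperm_of_card_porbits[a [b [_ gE]]]] gx].
  exists (g x); last first.
    by move: gx; rewrite gE; case: tpermP => [->|->|]; rewrite ?eqxx // tpermC.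
  rewrite !inE gx; move: gG gx; rewrite gE.
  case: tpermP => [->|->|]; rewrite ?eqxx //.
  by rewrite tpermC.
rewrite (exchange_big_dep (fun g => g \in transpositions G)) /=; last first.
  by move=> x g _ /andP[].
apply: eq_bigr => g gG; rewrite sum1dep_card; congr #|pred_of_set _|.
by apply/setP => x; move: gG; rewrite !inE => ->.
Qed.

Lemma card_moved_transposition (g : {perm T}) :
  g \in transpositions G -> #|[set x | g x != x]| = 2.
Proof.
rewrite inE => /andP[_ /eqP/tperm_of_card_porbits[a [b [nab ->]]]].
by rewrite card_moved_tperm // cards2 nab.
Qed.

(** As [G] preserves [A], the two points moved by a transposition lie both inside or both outside
    [A]. *)
Lemma card_moved_outside (g : {perm T}) :
  g \in transpositions G -> #|[set x in ~: A | g x != x]| = (fixes A g).*2.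
Proof.
move=> gtr; have c2 := card_moved_transposition gtr.
move: gtr; rewrite inE => /andP[gG /eqP/tperm_of_card_porbits[a [b [nab gE]]]].
have abA : (b \in A) = (a \in A) by rewrite -(centre_invariant a gG) gE tpermL.
have [/forall_inP fixA|] := boolP (fixes A g).
  apply: etrans c2; apply: eq_card => x; rewrite !inE.
  by case: (boolP (x \in A)) => //= /fixA ->.
rewrite negb_forall_in => /exists_inP[x xA gx].
have aA : a \in A.
  by move: gx xA; rewrite gE; case: tpermP => [->|->|]; rewrite ?abA // eqxx.
apply/eqP; rewrite cards_eq0; apply/eqP/setP => y; rewrite !inE gE.
by case: tpermP => [->|->|_ _]; rewrite ?abA ?aA // eqxx andbF.
Qed.

Lemma card_tperm_class_outside (x : T) : x \notin A -> #|tperm_class x :\ x| <= #|A|.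
Proof.
move=> xA; rewrite -ltnS -[_.+1]add1n.
have <- : (x \in tperm_class x) = 1%N :> nat by rewrite tperm_class_id.
rewrite -cardsD1; have [f feven] := even_stabiliser_colouring.
have f_inj : {in tperm_class x &, injective f}.
  move=> y z; rewrite !inE => xyG xzG fyz; apply/eqP; apply: contraT => nyz.
  have yzG : tperm y z \in G by apply: mem_tperm_trans xzG; rewrite tpermC.
  have := feven _ yzG; rewrite odd_tperm nyz; apply=> u.
  by case: tpermP => // ->.
by rewrite -(card_in_imset f_inj) -[X in _ <= X]card_ord max_card.
Qed.

Lemma card_tperm_class_inside (x : T) : x \in A -> #|tperm_class x :\ x| <= #|A|.-1.
Proof.
move=> xA; rewrite -ltnS prednK; last by apply/card_gt0P; exists x.
apply: proper_card; apply/properP; split; last by exists x => //; rewrite !inE eqxx.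
by apply/subsetP => y /setD1P[_ /tperm_class_mem ->].
Qed.

(** Let t count the transpositions of [G], u those fixing [A] pointwise, and put a = |A|, m = |~:
    A|. The bounds on the classes sum to 2t <= a(a-1) + ma and 2u <= ma, while t + u = a(a-1)/2 +
    ma; hence equality holds throughout, class by class. *)
Lemma card_tperm_class_eq (x : T) :
  #|tperm_class x :\ x| = if x \in A then #|A|.-1 else #|A|.
Proof.
have tot : \sum_(x in [set: T]) #|tperm_class x :\ x| = #|transpositions G|.*2.
  rewrite sum_card_tperm_class -muln2 -sum_nat_const; apply: eq_bigr => g gG.
  by rewrite -(card_moved_transposition gG); apply: eq_card => y; rewrite !inE.
have out : \sum_(x in ~: A) #|tperm_class x :\ x|
           = #|[set g in transpositions G | fixes A g]|.*2.
  rewrite sum_card_tperm_class -muln2 -sum_nat_const [RHS]big_mkcond [LHS]big_mkcond.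
  apply: eq_bigr => g _; rewrite [in RHS]in_set; case: ifP => //= gG.
  by rewrite card_moved_outside //; case: (fixes A g).
pose bd x := if x \in A then #|A|.-1 else #|A|.
have le_bd y : #|tperm_class y :\ y| <= bd y ?= iff (#|tperm_class y :\ y| == bd y).
  split=> //; rewrite /bd; case: ifP => [/card_tperm_class_inside //|/negbT].
  exact: card_tperm_class_outside.
have [le_tot tot_eq] := leqif_sum (fun y (_ : y \in setT) => le_bd y).
have [le_out out_eq] := leqif_sum (fun y (_ : y \in ~: A) => le_bd y).
have bd_out : \sum_(y in ~: A) bd y = (#|~: A| * #|A|)%N.
  by rewrite -sum_nat_const; apply: eq_bigr => y; rewrite inE /bd => /negPf->.
have bd_tot : \sum_(y in setT) bd y = (#|A| * #|A|.-1 + #|~: A| * #|A|)%N.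
  rewrite -bd_out (bigID (mem A)) /= -sum_nat_const; congr (_ + _).
    by apply: eq_big => y; rewrite ?inE // /bd => /andP[_ ->].
  by apply: eq_bigl => y; rewrite !inE.
have cT := card_transpositions; rewrite bin2_sum in cT.
have cb : 'C(#|A|, 2).*2 = (#|A| * #|A|.-1)%N by rewrite -mul2n -mul_bin_diag bin1.
have [eq_tot _] :
    \sum_(y in setT) bd y = #|transpositions G|.*2
    /\ \sum_(y in ~: A) bd y = #|[set g in transpositions G | fixes A g]|.*2.
  by split; lia.
move: tot_eq; rewrite tot eq_tot eqxx => /esym/forall_inP/(_ x (in_setT x))/eqP.
by [].
Qed.
Lemma tperm_class_centre (x : T) : x \in A -> tperm_class x = A.
Proof.
move=> xA; apply/eqP; rewrite eqEcard; apply/andP; split.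
  by apply/subsetP => y /tperm_class_mem ->.
rewrite (cardsD1 x (tperm_class x)) tperm_class_id card_tperm_class_eq xA.
by rewrite add1n prednK //; apply/card_gt0P; exists x.
Qed.

Lemma card_tperm_class_point (x : T) : x \notin A -> #|tperm_class x| = #|A|.+1.
Proof.
move=> xA; rewrite (cardsD1 x) tperm_class_id card_tperm_class_eq (negPf xA).
by rewrite add1n.
Qed.

Lemma tperm_class_eq (x y : T) :
  y \in tperm_class x -> tperm_class y = tperm_class x.
Proof.
move=> yx; apply/setP => z; move: yx; rewrite !inE => xyG.
by apply/idP/idP; apply: mem_tperm_trans; rewrite // tpermC.
Qed.

(** * The direct decomposition of [G] *)

Lemma Sym_centre_sub : Sym A \subset G.
Proof.
apply/subsetP => g; rewrite inE => gS; apply: mem_of_tperms => x.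
have [xA|xA] := boolP (x \in A); last by rewrite (out_perm gS xA) tperm1 group1.
have : g x \in tperm_class x by rewrite tperm_class_centre // perm_closed.
by rewrite inE.
Qed.

Lemma dprod_points_centre : (G :&: Sym (~: A)) \x Sym A = G.
Proof.
have cents : Sym A \subset 'C(G :&: Sym (~: A)).
  apply/centsP => h; rewrite inE => hS g /setIP[_]; rewrite inE => gS.
  by apply: perm_onC hS gS _; rewrite disjoints_subset setCK.
rewrite dprodE //; last first.
  apply/trivgP/subsetP => g /setIP[/setIP[_]]; rewrite !inE => gS gS'.
  apply/eqP/permP => x; rewrite perm1; have [xA|xA] := boolP (x \in A).
    by apply: out_perm gS _; rewrite inE xA.
  exact: out_perm gS' xA.
apply/eqP; rewrite eqEsubset mul_subG ?subsetIl ?Sym_centre_sub //=.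
(* [z] is the action of [g] on [A] extended by the identity. It lies in [G] because [Sym A] does,
   and dividing it off leaves an element supported outside [A]. *)
apply/subsetP => g gG; pose z := restr_perm A g.
have zS : z \in Sym A by rewrite inE restr_perm_on.
have gN : g \in 'N(A | 'P).
  by apply/astabsP => x; apply: centre_invariant.
apply/mulsgP; exists (g * z^-1) z => //; last by rewrite mulgKV.
have zG := subsetP Sym_centre_sub _ zS.
rewrite inE groupM ?groupV // inE.
apply/subsetP => x; rewrite !inE; apply: contraNN => xA.
by rewrite permM -[g x](restr_permE gN xA) permK.
Qed.

(** * The blocks and the action on them *)

(** The second clause makes the blocks the transposition classes, which ties the labelling to
    [G]. *)
Definition class_labelling (r : nat) (phi : 'I_r * 'I_(#|A|.+1) -> T) : Prop :=
  block_labelling phi (~: A) /\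
  forall p q, (tperm (phi p) (phi q) \in G) = (p.1 == q.1).

Lemma class_labelling_exists :
  exists r (phi : 'I_r * 'I_(#|A|.+1) -> T), class_labelling phi.
Proof.
pose P := tperm_class @: ~: A; exists #|P|.
have repP (i : 'I_#|P|) : exists x, x \notin A /\ enum_val i = tperm_class x.
  by have /imsetP[x xA ->] := enum_valP i; exists x; rewrite inE in xA.
have {repP} [rep repP] := fin_all_exists repP.
(* The default of [nth] is never returned: all classes of points have |A|+1 elements, so by [sz]
   every label is a valid index. *)
pose phi (p : 'I_#|P| * 'I_(#|A|.+1)) :=
  nth (rep p.1) (enum (tperm_class (rep p.1))) p.2.
have sz (p : 'I_#|P| * 'I_(#|A|.+1)) : p.2 < size (enum (tperm_class (rep p.1))).
  by case: (repP p.1) => xA _; rewrite -cardE card_tperm_class_point.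
have phi_class p : phi p \in tperm_class (rep p.1) by rewrite -mem_enum mem_nth.
have phiR p q : (tperm (phi p) (phi q) \in G) = (p.1 == q.1).
  have -> : (tperm (phi p) (phi q) \in G) = (phi q \in tperm_class (phi p)).
    by rewrite inE.
  rewrite (tperm_class_eq (phi_class p)); apply/idP/eqP => [qp|->//].
  apply: enum_val_inj; case: (repP p.1) => _ ->; case: (repP q.1) => _ ->.
  by rewrite -(tperm_class_eq qp) (tperm_class_eq (phi_class q)).
exists phi; split=> //; split=> [[i a] [j b] eqphi|].
  have ij : i = j by apply/eqP; rewrite -(phiR (i, a) (j, b)) eqphi tperm1 group1.
  rewrite -{}ij in eqphi *; congr (_, _); apply/val_inj/eqP.
  by rewrite -(nth_uniq (rep i) (sz (i, a)) (sz (i, b)) (enum_uniq _)); apply/eqP.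
apply/setP => x; rewrite inE; apply/imsetP/idP => [[p _ ->]|xA].
  by rewrite (tperm_class_mem (phi_class p)); case: (repP p.1).
have xP : tperm_class x \in P by apply: imset_f; rewrite inE.
pose i := enum_rank_in xP (tperm_class x).
have iE : tperm_class (rep i) = tperm_class x.
  by case: (repP i) => _ <-; rewrite enum_rankK_in.
have xi : x \in enum (tperm_class (rep i)) by rewrite mem_enum iE tperm_class_id.
have lt_a : index x (enum (tperm_class (rep i))) < #|A|.+1.
  by rewrite -(@card_tperm_class_point x) // -iE cardE index_mem.
by exists (i, Ordinal lt_a); rewrite // /phi /= nth_index.
Qed.

Lemma class_labelling_action (r : nat) (phi : 'I_r * 'I_(#|A|.+1) -> T)
    (g : {perm T}) :
  class_labelling phi -> g \in G ->
  exists (s : 'S_r) (f : {ffun 'I_r -> 'S_(#|A|.+1)}),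
    forall i a, g (phi (i, a)) = phi (s i, f i a).
Proof.
move=> [[phi_inj phi_im] phiR] gG.
have phi_g p : exists q, g (phi p) = phi q.
  have : g (phi p) \in [set phi q | q : _].
    by rewrite phi_im inE centre_invariant // -in_setC -phi_im imset_f.
  by case/imsetP => q _ ->; exists q.
have {phi_g} [t tE] := fin_all_exists phi_g.
(* Conjugation by [g] carries transpositions of [G] to transpositions of [G], so [g] maps classes to
   classes. *)
have tR p q : ((t p).1 == (t q).1) = (p.1 == q.1).
  by rewrite -!phiR -!tE -tpermJ groupJr.
have t_inj : injective t.
  by move=> p q tpq; apply/phi_inj/(@perm_inj _ g); rewrite !tE tpq.
(* The image of block [i] is read off at label 0; by [tR] any other label gives the same block. *)
have s_inj : injective (fun i => (t (i, ord0)).1).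
  by move=> i j /eqP; rewrite tR => /eqP.
have f_inj i : injective (fun a => (t (i, a)).2).
  move=> a b eq2; have /eqP eq1 : (t (i, a)).1 == (t (i, b)).1 by rewrite tR.
  suff /t_inj[] : t (i, a) = t (i, b) by [].
  by rewrite [t (i, a)]surjective_pairing [t (i, b)]surjective_pairing eq1 eq2.
exists (perm s_inj), [ffun i => perm (@f_inj i)] => i a.
rewrite tE ffunE !permE; congr phi; rewrite [t (i, a)]surjective_pairing.
by congr (_, _); apply/eqP; rewrite tR.
Qed.

(** A base element moves each point within its class, so [mem_of_tperms] applies. *)
Lemma imprimitive_base_sub (r : nat) (phi : 'I_r * 'I_(#|A|.+1) -> T) :
  class_labelling phi -> imprimitive_base phi \subset G :&: Sym (~: A).
Proof.
move=> [[phi_inj phi_im] phiR]; apply/subsetP => g; rewrite inE phi_im.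
case/andP=> gS /exists_inP[s /set1P-> /existsP[f /forallP fE]].
rewrite inE gS andbT; apply: mem_of_tperms => x.
have [xA|xA] := boolP (x \in ~: A); last first.
  by move: gS; rewrite inE => /out_perm->; rewrite ?tperm1 ?group1.
move: xA; rewrite -phi_im => /imsetP[[i a] _ ->].
by rewrite (eqP (forallP (fE i) a)) phiR perm1.
Qed.

Lemma mem_imprimitive_wreath (r : nat) (phi : 'I_r * 'I_(#|A|.+1) -> T)
    (Q : {set 'S_r}) :
  class_labelling phi ->
  (forall g (s : 'S_r) (f : {ffun 'I_r -> 'S_(#|A|.+1)}), g \in G ->
    (forall i a, g (phi (i, a)) = phi (s i, f i a)) -> s \in Q) ->
  G :&: Sym (~: A) \subset imprimitive_wreath phi Q.
Proof.
move=> phiL GQ; apply/subsetP => g /setIP[gG gS].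
have [s [f fE]] := class_labelling_action phiL gG; case: phiL => [[_ phi_im] _].
rewrite inE phi_im gS; apply/exists_inP; exists s; first exact: GQ fE.
by apply/existsP; exists f; apply/forallP => i; apply/forallP => a; rewrite fE.
Qed.

(* A colouring with even stabiliser is injective on each block, so relabelling
   the blocks by it turns any lift of s respecting the labels into an element
   of its stabiliser. *)
Lemma top_component_even (r : nat) (phi : 'I_r * 'I_(#|A|.+1) -> T)
    (g : {perm T}) (s : 'S_r) (f : 'I_r -> 'S_(#|A|.+1)) :
  ~~ odd #|A| -> class_labelling phi -> g \in G ->
  (forall i a, g (phi (i, a)) = phi (s i, f i a)) -> ~~ odd_perm s.
Proof.
move=> evA [[phi_inj phi_im] phiR] gG gE.
have [c ceven] := even_stabiliser_colouring.
have c_inj i : injective (fun a => c (phi (i, a))).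
  move=> a b cab; apply/eqP; apply: contraT => nab.
  have abG : tperm (phi (i, a)) (phi (i, b)) \in G by rewrite phiR.
  have := ceven _ abG; rewrite odd_tperm (inj_eq phi_inj).
  rewrite xpair_eqE eqxx (negPf nab); apply=> x.
  by case: tpermP => // ->.
pose psi (p : 'I_r * 'I_(#|A|.+1)) := phi (p.1, (perm (@c_inj p.1))^-1 p.2).
have psi_inj : injective psi.
  by move=> [i a] [j b] /phi_inj /= [<-{j} /perm_inj ->].
have psi_im : [set psi p | p : _] = ~: A.
  rewrite -phi_im; apply/setP => x; apply/imsetP/imsetP => -[[i a] _ ->].
    by eexists; last by [].
  by exists (i, perm (@c_inj i) a); rewrite // /psi /= permK.
have [h [hE hfix hodd]] := block_lift s psi_inj.
have hG : h \in G.
  (* [h] and [g] induce the same permutation of the blocks, so [g^-1 * h] moves every vertex within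
     its class. *)
  rewrite -(groupMl _ (groupVr gG)); apply: mem_of_tperms => x.
  rewrite permM -{1}(permKV g x); set y := g^-1 x.
  have [yA|] := boolP (y \in A).
    have : g y \in tperm_class y by rewrite tperm_class_centre // centre_invariant.
    by rewrite inE tpermC hfix // psi_im inE yA.
  rewrite -in_setC -phi_im => /imsetP[[i a] _ ->].
  have -> : phi (i, a) = psi (i, perm (@c_inj i) a) by rewrite /psi /= permK.
  by rewrite hE {1}/psi /= permK gE phiR.
(* The block length |A|+1 is odd, so [h] has the parity of [s]; it preserves [c] because the labels
   of [psi] are the colours. *)
have := ceven h hG; rewrite hodd /= evA; apply=> x.
have [|xA] := boolP (x \in ~: A); last by rewrite hfix // psi_im.
rewrite -psi_im => /imsetP[[i a] _ ->]; rewrite hE.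
have cpsi j b : c (psi (j, b)) = b by rewrite -[RHS](permKV (perm (@c_inj j))) permE.
by rewrite !cpsi.
Qed.

End Reciprocity.

(** * Assembly and passage to the numbered star *)

Lemma star_reciprocal_pair (T : finType) (A : {set T}) (k : nat)
    (G : {group {perm T}}) :
  #|A| = k -> 1 < #|~: A| -> reciprocal_pair (star A) G ->
  exists r, #|~: A| = (r * k.+1)%N /\
    [/\ G :&: Sym (~: A) \subset Sym (~: A),
        (G :&: Sym (~: A)) \x Sym A = G,
        odd k ->
          exists phi : 'I_r * 'I_k.+1 -> T,
            [/\ block_labelling phi (~: A),
                imprimitive_base phi \subset G :&: Sym (~: A)
              & G :&: Sym (~: A) \subset imprimitive_wreath phi [set: 'S_r]]
      & ~~ odd k ->
          exists phi : 'I_r * 'I_k.+1 -> T,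
            [/\ block_labelling phi (~: A),
                imprimitive_base phi \subset G :&: Sym (~: A)
              & G :&: Sym (~: A) \subset imprimitive_wreath phi 'Alt_('I_r)]].
Proof.
move=> <-{k} A2 recG; have [r [phi phiL]] := class_labelling_exists A2 recG.
have phiD := phiL.1; have base := imprimitive_base_sub phiL.
exists r; split.
  by rewrite -phiD.2 card_imset ?card_prod ?card_ord //; case: phiD.
split=> [||_|evA]; first exact: subsetIr.
- exact: dprod_points_centre.
- exists phi; split=> //; apply: mem_imprimitive_wreath => // g s f _ _.
  by rewrite inE.
- exists phi; split=> //; apply: mem_imprimitive_wreath => // g s f gG gE.
  by rewrite Alt_even; apply: (top_component_even A2 recG evA phiL gG gE).
Qed.

Theorem theorem1 (k n : nat) (hk : (1 <= k)%N) (hn : (2 * k + 1 <= n)%N)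
    (G : {group 'S_n}) (hG : reciprocal_pair (@kstar n k) G) :
  exists r : nat,
    n = (r * k.+1 + k)%N /\
    exists Gbar : {group 'S_n},
      [/\ Gbar \subset Sym (points n k),
          (Gbar \x Sym (centre n k) = G)%g,
          odd k ->
            exists phi : 'I_r * 'I_k.+1 -> 'I_n,
              [/\ block_labelling phi (points n k),
                  imprimitive_base phi \subset Gbar
                & Gbar \subset imprimitive_wreath phi [set: 'S_r]]
        & ~~ odd k ->
            exists phi : 'I_r * 'I_k.+1 -> 'I_n,
              [/\ block_labelling phi (points n k),
                  imprimitive_base phi \subset Gbar
                & Gbar \subset imprimitive_wreath phi ('Alt_('I_r))%g]].
Proof.
have cA : #|centre n k| = k.
  have le_kn : k <= n by lia.
  have widen_inj : injective (widen_ord le_kn) by move=> i j [/val_inj].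
  rewrite -[RHS]card_ord -(card_imset _ widen_inj).
  apply: eq_card => i; rewrite inE; apply/idP/imsetP => [ik|[j _ ->] /=].
    by exists (Ordinal ik) => //; apply/val_inj.
  exact: ltn_ord.
have cP : #|points n k| = n - k by rewrite cardsCs setCK cA card_ord.
(* There are n - k >= k + 1 >= 2 points. *)
have A2 : 1 < #|~: centre n k| by rewrite -/(points n k) cP; lia.
have recG : reciprocal_pair (star (centre n k)) G by [].
have [r [nE [Gb1 Gb2 Gb3 Gb4]]] := star_reciprocal_pair cA A2 recG.
exists r; split; first by move: nE; rewrite -/(points n k) cP; lia.
by exists (G :&: Sym_group (points n k))%G.
Qed.
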